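(* There exists an absolute constant $c>0$ such that for every integer $m\ge 2$ and every subset $A\subset\mathbb{Z}_m$, $$ |A+A|\,|AA|\ \ge\ c\,\min\Bigl\{\,m|A|,\ \frac{|A|^{4}}{m}\Bigl(\sum_{\substack{d\mid m\\ d<m}}d^{1/2}\Bigr)^{-2}\Bigr\}, $$ where the sum runs over all positive divisors $d$ of $m$ with $d<m$.
   Context: $\mathbb{Z}_m$ denotes the ring of residue classes modulo $m$, and $|X|$ denotes the cardinality of a finite set $X$. For $A\subset\mathbb{Z}_m$, the sum set is $A+A=\{a+b:\ a\in A,\ b\in A\}$ and the product set is $AA=\{ab:\ a\in A,\ b\in A\}$. The constant $c$ does not depend on $m$ or $A$ (the paper writes this inequality with the symbol $\gg$). *)

(* Defs.v *)
From mathcomp Require Import all_boot all_order all_algebra.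
From mathcomp Require Import reals.

Set Implicit Arguments.
Unset Strict Implicit.
Unset Printing Implicit Defensive.

Import Order.TTheory GRing.Theory Num.Theory.
Local Open Scope ring_scope.

(* 'Z_m is the ring of residues modulo m only for m >= 2; for m = 0, 1 it is
   Z/2Z. *)
Definition sumset (m : nat) (A : {set 'Z_m}) : {set 'Z_m} :=
  [set a + b | a in A, b in A].

Definition prodset (m : nat) (A : {set 'Z_m}) : {set 'Z_m} :=
  [set a * b | a in A, b in A].

Definition sqrt_divisor_sum (R : realType) (m : nat) : R :=
  \sum_(d <- divisors m | (d < m)%N) Num.sqrt d%:R.

(* Main.v *)
Require Import Defs.
From mathcomp Require Import all_boot all_order all_algebra.
From mathcomp Require Import reals.
From mathcomp Require Import ring lra zify.

Import Order.TTheory GRing.Theory Num.Theory.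
Local Open Scope ring_scope.

(** Write S = A + A, P = AA, N = |S| |P| and let s be the sum of sqrt d over
    the proper divisors d of m. At least half of A consists of units, or at
    least half of A consists of non-units.

    If the units U of A make up half of A, count incidences between the points
    (y, z) of P x S and the lines y = u (z - b), with u in U and b in A. The
    line (u, b) carries the |A| points (uc, b + c), so there are at least
    |U| |A|^2 incidences, whereas a random configuration would have
    |U| |A| N / m. The deviation is controlled by the second moment of the
    incidence function over all of Z_m x Z_m. Two lines whose slopes differ by
    a unit meet in exactly one point, as random lines would on average, so
    only pairs of slopes with a non-unit difference contribute to the
    variance, which is therefore at most m |U| |A| nu with nu the number of
    non-units ([sum_incid_sqr]). By Cauchy-Schwarz, either N >= m|A|/2 or
    N >= |U| |A|^3 / (4 m nu) ([sum_product_units]). Finally nu <= s^2.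

    If the non-units V of A make up half of A, note that x in V has additive
    order d = m / gcd(m, x), a proper divisor of m, and that multiplication by
    x is gcd(m, x)-to-one, so that |A| <= |P| m / d: every such d is at most
    L = |P| m / |A|. At most d residues have additive order d, hence |V| is at
    most the sum of these d, thus at most sqrt L * s ([card_nonunits_le]).
    Squaring gives |P| >= |A|^3 / (4 m s^2), and |S| >= |A|.

    The bound nu <= s^2 is the same estimate with L = s^2. *)

(** * Incidences in a finite commutative ring *)

Lemma sqr_sum_le (R : realDomainType) (I : finType) (P : {set I}) (g : I -> R) :
  (\sum_(i in P) g i) ^+ 2 <= #|P|%:R * \sum_(i in P) g i ^+ 2.
Proof.
rewrite -(@ler_pM2l _ 2) // expr2.
have -> : 2 * ((\sum_(i in P) g i) * (\sum_(i in P) g i)) =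
    \sum_(i in P) \sum_(j in P) 2 * (g i * g j).
  by rewrite mulr_suml mulr_sumr; apply: eq_bigr => i _; rewrite !mulr_sumr.
have -> : 2 * (#|P|%:R * \sum_(i in P) g i ^+ 2) =
    \sum_(i in P) \sum_(j in P) (g i ^+ 2 + g j ^+ 2).
  under [RHS]eq_bigr do rewrite big_split /= sumr_const.
  by rewrite big_split /= sumr_const sumrMnl mulr_natl mulr_natl mulr2n.
apply: ler_sum => i _; apply: ler_sum => j _.
by rewrite -subr_ge0 (_ : _ - _ = (g i - g j) ^+ 2) ?sqr_ge0 //; ring.
Qed.

Section SecondMoment.

Variables (F : finComUnitRingType) (U B C : {set F}).
Hypothesis unitU : {in U, forall u, u \is a GRing.unit}.

Definition nonunits : {set F} := [set x | x \isn't a GRing.unit].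

(** The number of lines y = u (z - b), with (u, b) in U x B, through the point
    p = (y, z). *)
Definition incid (p : F * F) : nat :=
  \sum_(l in setX U B) (l.1 * (p.2 - l.2) == p.1)%R.

Lemma sum_incid : (\sum_p incid p = #|F| * (#|U| * #|B|))%N.
Proof.
rewrite exchange_big /= (eq_bigr (fun=> #|F|)).
  by rewrite sum_nat_const cardsX mulnC.
move=> [u b] _ /=.
rewrite -(pair_bigA _ (fun y z => (u * (z - b) == y) : nat)) /= exchange_big /=.
rewrite (eq_bigr (fun=> 1%N)) ?sum1_card // => z _.
by rewrite (bigD1 (u * (z - b))) //= eqxx big1 // => y /negPf; rewrite eq_sym => ->.
Qed.

(** Two lines whose slopes differ by a unit meet in exactly one point, because
    the coordinate z of that point solves (u - u') z = ub - u'b'. *)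
Lemma meet_unit (u u' b b' : F) : u - u' \is a GRing.unit ->
  (\sum_(z : F) (u * (z - b) == u' * (z - b'))%R = 1)%N.
Proof.
move=> Uuu'.
have E z : (u * (z - b) == u' * (z - b')) = (z == (u * b - u' * b') / (u - u')).
  rewrite -[RHS](inj_eq (mulIr Uuu')) divrK //.
  rewrite -subr_eq0 -[RHS]subr_eq0; congr (_ == 0); ring.
rewrite (bigD1 ((u * b - u' * b') / (u - u'))) //= E eqxx big1 // => z.
by rewrite E => /negPf ->.
Qed.

(** This holds whether or not u - u' is a unit: a point of the line (u, b) lies
    on a single line of unit slope u'. *)
Lemma meet_le (u u' b : F) : u' \is a GRing.unit ->
  (\sum_(b' in B) \sum_(z : F) (u * (z - b) == u' * (z - b'))%R <= #|F|)%N.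
Proof.
move=> Uu'; rewrite exchange_big /= -sum1_card; apply: leq_sum => z _.
pose w := z - u * (z - b) / u'.
have E b' : (u * (z - b) == u' * (z - b')) = (b' == w).
  rewrite -[RHS](inj_eq (mulIr Uu')) mulrBl divrK //.
  rewrite -subr_eq0 -[RHS]subr_eq0; congr (_ == 0); ring.
apply: (@leq_trans (\sum_(b' : F) (b' == w))%N); last first.
  by rewrite (bigD1 w) //= eqxx big1 // => b' /negPf ->.
by rewrite big_mkcond; apply: leq_sum => b' _; rewrite E; case: ifP.
Qed.

(** The left side counts pairs of lines together with a common point. The pairs
    whose slopes differ by a unit account for the main term, which is the square
    of the mean of [incid] times the number of points; for every u there are at
    most |nonunits| slopes u' left, and they are handled by [meet_le]. *)
Lemma sum_incid_sqr :
  (\sum_p incid p ^ 2 <=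
     (#|U| * #|B|) ^ 2 + #|F| * (#|U| * #|B|) * #|nonunits|)%N.
Proof.
have -> : (\sum_p incid p ^ 2 = \sum_(u in U) \sum_(u' in U) \sum_(b in B)
    \sum_(b' in B) \sum_(z : F) (u * (z - b) == u' * (z - b'))%R)%N.
  transitivity (\sum_(l in setX U B) \sum_(l' in setX U B)
     \sum_(z : F) (l.1 * (z - l.2) == l'.1 * (z - l'.2))%R)%N.
    under eq_bigr do rewrite expnS expn1 big_distrlr /=.
    rewrite exchange_big; apply: eq_bigr => l _ /=.
    rewrite exchange_big; apply: eq_bigr => l' _ /=.
    rewrite -(pair_bigA _ (fun y z => (l.1 * (z - l.2) == y)%R *
      (l'.1 * (z - l'.2) == y)%R)%N) /= exchange_big /=.
    apply: eq_bigr => z _.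
    rewrite (bigD1 (l.1 * (z - l.2))) //= eqxx mul1n eq_sym big1 ?addn0 //.
    by move=> y /negPf; rewrite eq_sym => ->.
  under eq_bigl do rewrite inE.
  rewrite -(pair_big (mem U) (mem B) (fun u b => \sum_(l' in setX U B)
     \sum_(z : F) (u * (z - b) == l'.1 * (z - l'.2))%R)%N) /=.
  apply: eq_bigr => u _.
  rewrite [RHS]exchange_big; apply: eq_bigr => b _ /=.
  under eq_bigl do rewrite inE.
  by rewrite -(pair_big (mem U) (mem B) (fun u' b' => 
     \sum_(z : F) (u * (z - b) == u' * (z - b'))%R)%N).
apply: (@leq_trans (\sum_(u in U) (#|U| * #|B| ^ 2 +
    #|nonunits| * (#|F| * #|B|)))%N); last first.
  by rewrite sum_nat_const; lia.
apply: leq_sum => u uU.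
apply: (@leq_trans (\sum_(u' in U) (#|B| ^ 2 +
    (u - u' \in nonunits)%R * (#|F| * #|B|)))%N).
  apply: leq_sum => u' /unitU Uu'.
  rewrite inE; have [Uuu'|_] := boolP (u - u' \is a _); last first.
    rewrite mul1n; apply: leq_trans (leq_addl _ _).
    rewrite mulnC -sum_nat_const; apply: leq_sum => b _; exact: meet_le.
  rewrite addn0 expnS expn1 -[leqRHS]sum_nat_const.
  apply: leq_sum => b _; rewrite -sum1_card.
  by apply: leq_sum => b' _; rewrite meet_unit.
rewrite big_split /= sum_nat_const leq_add2l -big_distrl leq_mul2r; apply/orP; right.
rewrite (_ : \sum_(_ in U) _ = #|[set u' in U | (u - u' \in nonunits)%R]|)%N.
  rewrite -(card_imset _ (subrI u)); apply: subset_leq_card.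
  by apply/subsetP => _ /imsetP[u' /[!inE]/andP[_ ?] ->].
by rewrite -big_mkcondr sum1dep_card; apply: eq_card => ?; rewrite !inE.
Qed.

(** Garaev's sum-product argument, with the estimate of exponential sums
    replaced by the variance bound [sum_incid_sqr]. *)
Lemma sum_product_units (S := [set b + c | b in B, c in C]%R)
    (P := [set u * c | u in U, c in C]) (N := (#|S| * #|P|)%N) :
  (#|F| * #|C| <= 2 * N)%N \/
  (#|U| * #|B| * #|C| ^ 2 <= 4 * #|F| * #|nonunits| * N)%N.
Proof.
have [|ltN] := leqP (#|F| * #|C|)%N (2 * N)%N; [by left | right].
have [->//|h_gt0] := posnP (#|U| * #|B|)%N.
set q := #|F| in ltN *; set h := (#|U| * #|B|)%N in h_gt0 *.
set nu := #|nonunits|.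
have q_gt0 : (0 < q)%N by rewrite /q; apply/card_gt0P; exists 0.
(* |F| times the deviation of [incid] from its mean, so as to stay in int *)
pose g p : int := q%:Z * (incid p)%:Z - h%:Z.
(* the line (u, b) passes through (uc, b + c) for every c in C *)
have sumI : (h * #|C| <= \sum_(p in setX P S) incid p)%N.
  rewrite exchange_big /= /h -cardsX -sum_nat_const; apply: leq_sum => -[u b].
  rewrite inE /= => /andP[uU bB].
  rewrite (_ : \sum_(_ in _) _ =
     #|[set p in setX P S | (u * (p.2 - b) == p.1)%R]|)%N; last first.
    by rewrite -big_mkcondr sum1dep_card; apply: eq_card => ?; rewrite !inE.
  have injf : injective (fun c => (u * c, b + c)) by move=> c c' [_ /addrI].
  rewrite -(card_imset _ injf); apply: subset_leq_card.
  apply/subsetP => _ /imsetP[c cC ->]; rewrite !inE /= addrAC subrr add0r eqxx andbT.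
  by rewrite !imset2_f.
have sumg : 2 * \sum_(p in setX P S) g p >= (q * h * #|C|)%:Z.
  rewrite /g sumrB sumr_const cardsX -mulr_sumr -mulr_natl natz.
  rewrite (_ : \sum_(i in _) _ = (\sum_(p in setX P S) incid p)%N%:Z); last first.
    by rewrite -natz natr_sum; apply: eq_bigr => p _; rewrite natz.
  move: sumI; set I := (\sum_(p in _) _)%N => sumI.
  rewrite mulnC -/N.
  have : (q * (h * #|C|) <= q * I)%N by rewrite leq_mul2l sumI orbT.
  have : (2 * N * h <= q * #|C| * h)%N by rewrite leq_mul2r ltnW ?orbT.
  by lia.
have sumg2 : \sum_p g p ^+ 2 <= (q ^ 3 * h * nu)%:Z.
  have -> : \sum_p g p ^+ 2 = (q ^ 2 * \sum_p incid p ^ 2)%N%:Z - (q ^ 2 * h ^ 2)%N%:Z.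
    have gE p : g p ^+ 2 = (q ^ 2)%:Z * (incid p ^ 2)%:Z
       - (2 * q * h)%:Z * (incid p)%:Z + (h ^ 2)%:Z.
      by rewrite /g !expnS !expn0 expr2; lia.
    rewrite (eq_bigr _ (fun p _ => gE p)) big_split sumrB /= sumr_const card_prod -!mulr_sumr.
    have nat_sum (f : F * F -> nat) : \sum_p (f p)%:Z = (\sum_p f p)%N%:Z.
      by rewrite -[RHS]natz natr_sum; apply: eq_bigr => p _; rewrite natz.
    rewrite !nat_sum sum_incid -/q -/h -mulr_natl natz.
    by set I2 := (\sum_p _)%N; rewrite !expnS !expn0 !muln1 !PoszM; ring.
  have := sum_incid_sqr; rewrite -/q -/h -/nu => le2.
  have : (q ^ 2 * \sum_p incid p ^ 2 <= q ^ 2 * (h ^ 2 + q * h * nu))%N.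
    by rewrite leq_mul2l le2 orbT.
  set I2 := (\sum_p _)%N => le3.
  rewrite lerBlDr -PoszD lez_nat; apply: leq_trans le3 _.
  by rewrite !expnS !expn0; lia.
have CS := sqr_sum_le _ _ (setX P S) g.
have : (q * h * #|C|)%:Z ^+ 2 <= 4 * (N * (q ^ 3 * h * nu))%:Z.
  apply: (@le_trans _ _ ((2 * \sum_(p in setX P S) g p) ^+ 2)).
    by rewrite ler_sqr ?nnegrE // (le_trans _ sumg).
  rewrite exprMn (_ : 2 ^+ 2 = 4 :> int) // ler_pM2l //.
  apply: le_trans CS _; rewrite cardsX mulnC -/N natz PoszM ler_wpM2l //.
  apply: le_trans sumg2.
  by rewrite [leRHS](bigID (mem (setX P S))) /= lerDl sumr_ge0 // => p _; rewrite sqr_ge0.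
have q2h : (0 < q ^ 2 * h)%N by rewrite muln_gt0 expn_gt0 q_gt0.
rewrite -(leq_pmul2l q2h); lia.
Qed.

End SecondMoment.

(** * Additive orders of residues *)

Section Residues.
Variables (n : nat).
Let m := n.+2.
Implicit Types (x y a : 'Z_m) (A : {set 'Z_m}).

Lemma card_multiples d : (d %| m)%N -> (#|[set y : 'Z_m | (d %| y)%N]| <= m %/ d)%N.
Proof.
move=> dm; have d_gt0 : (0 < d)%N by apply: dvdn_gt0 dm.
rewrite -[leqRHS]card_ord.
have lt y : (y %/ d < m %/ d)%N by rewrite ltn_divLR // divnK // ltn_ord.
pose f y := Ordinal (lt y).
rewrite -(@card_in_imset _ _ f) ?max_card // => x y.
rewrite !inE => dx dy [] E; apply: val_inj => /=.
by rewrite -(divnK dx) E divnK.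
Qed.

Definition additive_order x : nat := (m %/ gcdn m x)%N.

Lemma additive_order_dvd x : (additive_order x %| m)%N.
Proof. by rewrite dvdn_div ?dvdn_gcdl. Qed.

Lemma additive_order_gcd x : (additive_order x * gcdn m x = m)%N.
Proof. by rewrite divnK ?dvdn_gcdl. Qed.

Lemma additive_order_lt x : x \isn't a GRing.unit -> (additive_order x < m)%N.
Proof.
rewrite -[x]natr_Zp unitZpE // natr_Zp /additive_order /coprime => g1.
by rewrite ltn_Pdiv // ltn_neqAle eq_sym g1 gcdn_gt0.
Qed.

(** The annihilator of a consists of the multiples of the additive order of a. *)
Lemma card_annihilator a : (#|[set y : 'Z_m | (a * y == 0)%R]| <= gcdn m a)%N.
Proof.
rewrite -[leqRHS](mulKn _ (_ : (0 < additive_order a)%N)) ?additive_order_gcd; last first.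
  exact: dvdn_gt0 (additive_order_dvd a).
apply: leq_trans (card_multiples _ (additive_order_dvd a)).
apply: subset_leq_card; apply/subsetP => y; rewrite !inE => /eqP ay0.
have /eqP : (a * y %% m = 0)%N by have := congr1 val ay0.
rewrite -/(dvdn m _) -{1}(additive_order_gcd a).
have g_gt0 : (0 < gcdn m a)%N by rewrite gcdn_gt0.
rewrite -[X in (_ %| X * _)%N](divnK (dvdn_gcdr m a)) mulnAC dvdn_pmul2r // mulnC Gauss_dvdl //.
by rewrite /coprime -(eqn_pmul2r g_gt0) mul1n muln_gcdl !divnK ?dvdn_gcdl ?dvdn_gcdr.
Qed.

(** The fibres of multiplication by a are translates of its annihilator. *)
Lemma card_le_dilate A a : (#|A| <= #|[set (a * y)%R | y in A]| * gcdn m a)%N.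
Proof.
rewrite -sum1_card (partition_big_imset (fun y => a * y)) /= -sum_nat_const.
apply: leq_sum => _ /imsetP[y0 _ ->]; rewrite sum1dep_card.
apply: leq_trans (card_annihilator a).
rewrite -(card_imset _ (addIr (- y0))); apply: subset_leq_card.
apply/subsetP => _ /imsetP[y /[!inE] /andP[_ /eqP ay] ->].
by rewrite mulrDr mulrN ay subrr.
Qed.

(** The residues of additive order d are multiples of m / d, so there are at most
    d = sqrt d * sqrt d of them; one factor is bounded by sqrt L, and the other
    is summed over the proper divisors d of m. *)
Lemma card_nonunits_le (R : realType) (B : {set 'Z_m}) (L : R) :
  {in B, forall x, x \isn't a GRing.unit} ->
  {in B, forall x, (additive_order x)%:R <= L} ->
  #|B|%:R <= Num.sqrt L * sqrt_divisor_sum R m.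
Proof.
move=> nuB leB.
have -> : #|B|%:R = \sum_(d <- divisors m | (d < m)%N)
    #|[set x in B | additive_order x == d]|%:R :> R.
  rewrite -natr_sum; congr (_%:R).
  rewrite (eq_bigr (fun d => \sum_(x in B) (additive_order x == d))%N); last first.
    move=> d _; rewrite -[RHS]big_mkcondr sum1dep_card.
    by apply: eq_card => x; rewrite !inE.
  rewrite exchange_big /= -sum1_card; apply: eq_bigr => x xB.
  rewrite big_mkcond.
  rewrite (bigD1_seq (additive_order x)) ?divisors_uniq -?dvdn_divisors ?additive_order_dvd //=.
  rewrite eqxx additive_order_lt ?nuB // big1 // => d.
  by rewrite eq_sym => /negPf ->; case: ifP.
rewrite /sqrt_divisor_sum mulr_sumr big_seq_cond [leRHS]big_seq_cond.
apply: ler_sum => d; rewrite -dvdn_divisors // => /andP[dm _].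
have [->|[x]] := set_0Vmem [set x in B | additive_order x == d].
  by rewrite cards0 mulr_ge0 ?sqrtr_ge0.
rewrite inE => /andP[xB /eqP xd].
apply: (@le_trans _ _ d%:R).
  have kd : (m %/ d %| m)%N by rewrite dvdn_div.
  have d_gt0 : (0 < d)%N by apply: dvdn_gt0 dm.
  rewrite ler_nat [leqRHS](_ : d = m %/ (m %/ d))%N; last by rewrite divnA // mulKn.
  apply: leq_trans (card_multiples _ kd).
  apply: subset_leq_card; apply/subsetP => y; rewrite !inE => /andP[_ /eqP yd].
  by rewrite -yd -{1}(additive_order_gcd y) mulKn ?dvdn_gcdr // yd.
have dL : d%:R <= L by rewrite -xd leB.
rewrite -[leLHS]sqr_sqrtr // expr2 ler_wpM2r ?sqrtr_ge0 // ler_wsqrtr //.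
Qed.

End Residues.

(** * The sum-product estimate *)

Theorem theorem2 (R : realType) :
  exists2 c : R, 0 < c &
    forall (m : nat) (A : {set 'Z_m}), (2 <= m)%N ->
      c * Num.min (m%:R * #|A|%:R)
                  (#|A|%:R ^+ 4 / m%:R * sqrt_divisor_sum R m ^- 2)
      <= #|sumset A|%:R * #|prodset A|%:R.
Proof.
exists 8^-1; first by rewrite invr_gt0.
case=> [|[|n]] // A _; set m := n.+2.
set N : R := #|sumset A|%:R * _.
have N_ge0 : 0 <= N by rewrite mulr_ge0.
set s := sqrt_divisor_sum R m.
have s_ge_sqrt d : (d %| m)%N -> (d < m)%N -> Num.sqrt d%:R <= s.
  move=> dm ltdm; rewrite /s /sqrt_divisor_sum.
  rewrite big_mkcond (bigD1_seq d) ?divisors_uniq -?dvdn_divisors //= ltdm.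
  by rewrite lerDl sumr_ge0 // => e _; case: ifP; rewrite ?sqrtr_ge0.
have s_ge1 : 1 <= s by rewrite -(sqrtr1 R) (s_ge_sqrt 1%N) ?dvd1n.
have s_gt0 : 0 < s by rewrite (lt_le_trans _ s_ge1).
have m_gt0 : 0 < m%:R :> R by rewrite ltr0n.
suff [first_bound|second_bound] : m%:R * #|A|%:R <= 8 * N \/
    #|A|%:R ^+ 4 <= 8 * (m%:R * s ^+ 2 * N).
- by rewrite ler_pdivrMl // ge_min first_bound.
- rewrite ler_pdivrMl // ge_min; apply/orP; right.
  rewrite -mulrA -invfM ler_pdivrMr ?mulr_gt0 ?exprn_gt0 //.
  by apply: le_trans second_bound _; rewrite le_eqVlt; apply/orP; left; apply/eqP; ring.
have [A0|[a0 a0A]] := set_0Vmem A.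
  by left; rewrite A0 cards0 mulr0 mulr_ge0.
have A_gt0 : 0 < #|A|%:R :> R by rewrite ltr0n; apply/card_gt0P; exists a0.
pose U := A :&: [set x | x \is a GRing.unit].
pose V := A :\: [set x | x \is a GRing.unit].
have cardUV : #|A|%:R = #|U|%:R + #|V|%:R :> R by rewrite -natrD cardsID.
have [leAU|ltUA] := lerP #|A|%:R (2 * #|U|%:R : R).
- have unitU : {in U, forall u, u \is a GRing.unit} by move=> u /[!inE] /andP[].
  have nu_le : #|nonunits 'Z_m|%:R <= s ^+ 2.
    (* sqrt d <= s for every proper divisor d, so L = s^2 is admissible *)
    rewrite expr2 -{1}[s]gtr0_norm // -sqrtr_sqr.
    apply: card_nonunits_le => x; rewrite !inE // => nux.
    rewrite -[leLHS]sqr_sqrtr // ler_sqr ?nnegrE ?sqrtr_ge0 ?(ltW s_gt0) //.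
    by rewrite s_ge_sqrt ?additive_order_dvd ?additive_order_lt.
  have prodN : #|[set b + c | b in A, c in A]|%:R * #|[set u * c | u in U, c in A]|%:R <= N.
    rewrite ler_wpM2l // ler_nat subset_leq_card //.
    exact: imset2S (subsetIl _ _) (subxx _).
  have [SP SP_le] : exists2 SP : nat, SP%:R <= N &
      (m * #|A| <= 2 * SP)%N \/
      (#|U| * #|A| * #|A| ^ 2 <= 4 * m * #|nonunits 'Z_m| * SP)%N.
    exists (#|[set b + c | b in A, c in A]%R| * #|[set u * c | u in U, c in A]%R|)%N.
      by rewrite natrM.
    by have := @sum_product_units 'Z_m U A A unitU; rewrite card_ord.
  case; rewrite -(ler_nat R) !(natrM, natrX) => le_SP; [left; lra | right].
  apply: (@le_trans _ _ (2 * (#|U|%:R * #|A|%:R * #|A|%:R ^+ 2))).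
    rewrite [leLHS](_ : _ = #|A|%:R * (#|A|%:R * #|A|%:R ^+ 2)); last by ring.
    by rewrite -mulrA [leRHS]mulrA ler_wpM2r ?mulr_ge0 ?exprn_ge0.
  rewrite [leRHS](_ : _ = 2 * (4 * (m%:R * (s ^+ 2 * N)))); last by ring.
  rewrite ler_pM2l //; apply: le_trans le_SP _.
  by rewrite -[leLHS]mulrA -[leLHS]mulrA ler_pM2l // ler_pM2l // ler_pM.
- right.
  set K := #|prodset A|%:R : R.
  have V_le : #|V|%:R <= Num.sqrt (K * m%:R / #|A|%:R) * s.
    apply: card_nonunits_le => x; rewrite !inE => /andP[nux xA] //.
    rewrite ler_pdivlMr // -natrM -natrM ler_nat.
    rewrite -[X in (_ <= _ * X)%N](additive_order_gcd _ x) mulnCA leq_mul2l.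
    apply/orP; right.
    apply: leq_trans (card_le_dilate _ A x) _.
    rewrite leq_mul2r; apply/orP; right; apply: subset_leq_card.
    by apply/subsetP => _ /imsetP[y yA ->]; apply: imset2_f.
  have sumset_ge : #|A|%:R <= #|sumset A|%:R :> R.
    rewrite ler_nat -(card_imset _ (addrI a0)); apply: subset_leq_card.
    by apply/subsetP => _ /imsetP[y yA ->]; apply: imset2_f.
  have A2 : #|A|%:R ^+ 2 <= 4 * (K * m%:R / #|A|%:R * s ^+ 2).
    apply: (@le_trans _ _ ((2 * #|V|%:R) ^+ 2)).
      by rewrite ler_sqr ?nnegrE ?mulr_ge0 //; lra.
    have -> : (2 * #|V|%:R) ^+ 2 = 4 * #|V|%:R ^+ 2 :> R by ring.
    rewrite ler_pM2l //.
    rewrite -[X in X * s ^+ 2]sqr_sqrtr ?divr_ge0 ?mulr_ge0 //.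
    by rewrite -[leRHS]exprMn ler_sqr ?nnegrE // mulr_ge0 ?sqrtr_ge0 // ltW.
  have A3 : #|A|%:R ^+ 3 <= 4 * (K * m%:R * s ^+ 2).
    rewrite exprSr -ler_pdivlMr //; apply: le_trans A2 _.
    by rewrite le_eqVlt; apply/orP; left; apply/eqP; field; rewrite gt_eqF.
  rewrite exprSr; apply: (@le_trans _ _ (4 * (K * m%:R * s ^+ 2) * #|sumset A|%:R)).
    by rewrite ler_pM ?exprn_ge0.
  rewrite (_ : 4 * _ * _ = 4 * (m%:R * s ^+ 2 * N)); last by rewrite /N -/K; ring.
  by rewrite ler_wpM2r ?mulr_ge0 ?exprn_ge0 ?(ltW s_gt0) // ler_nat.
Qed.
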